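(* Formulation F7 is strictly tighter than Formulation F1 (both defined in the context). Explicitly: (i) for every instance $(T,M,(W_m)_{m\in M})$, every continuous solution $(X,S)$ of F7 is a continuous solution of F1; and (ii) there exist an instance and a continuous solution $(X,S)$ of F1 for that instance which is not a continuous solution of F7.
   Context: An instance of the generator maintenance scheduling problem consists of a horizon $T=\{1,2,\dots,|T|\}$ of periods, a finite nonempty set $M$ of maintenances, and a positive integer duration $W_m$ for each $m\in M$. The variables are $X_{t,m}$ (maintenance $m$ is executed in period $t$) and $S_{t,m}$ (maintenance $m$ starts in period $t$), for $t\in T$, $m\in M$. Conventions: $X_{t,m}=0$ whenever $t\le 0$ or $t>|T|$; $S_{t,m}=0$ whenever $t\le 0$, $t>|T|$, or $t\ge |T|-W_m+2$ (a maintenance cannot start so late that it would not finish within the horizon). In particular every solution is required to satisfy $S_{t,m}=0$ for $t\in T$ with $t\ge |T|-W_m+2$. Formulation F1 (variables $X,S$): $\sum_{t\in T}X_{t,m}=W_m$ for all $m\in M$; $\sum_{t\in T}S_{t,m}=1$ for all $m\in M$; $X_{t,m}-X_{t-1,m}\le S_{t,m}$ for all $t\in T$, $m\in M$; $X_{t,m},S_{t,m}\in\{0,1\}$ for all $t\in T$, $m\in M$. Formulation F7 (variables $X,S$): $\sum_{t\in T}S_{t,m}=1$ for all $m\in M$; $\sum_{t'=t-W_m+1}^{t}S_{t',m}=X_{t,m}$ for all $t\in T$, $m\in M$; $X_{t,m},S_{t,m}\in\{0,1\}$ for all $t\in T$, $m\in M$. A continuous solution of a formulation is a real assignment of its variables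 satisfying its linear relaxation, i.e. all its constraints with each condition ''$\in\{0,1\}$'' replaced by ''$\in[0,1]$''. A formulation A is at least as tight as B if all continuous solutions satisfying A also satisfy B; A is strictly tighter than B if A is at least as tight as B and there is at least one continuous solution satisfying B that does not satisfy A. *)

(* Defs.v *)
From mathcomp Require Import all_boot all_order all_algebra.
From mathcomp Require Import reals.

Set Implicit Arguments.
Unset Strict Implicit.
Unset Printing Implicit Defensive.

Import Order.TTheory GRing.Theory Num.Theory.
Local Open Scope ring_scope.

Record instance : Type := Instance {
  horizon : nat;
  maint : finType;
  maint_nonempty : (0 < #|maint|)%N;
  duration : maint -> nat;
  duration_gt0 : forall m, (0 < duration m)%N }.

(* The horizon {1, ..., |T|} is represented by 'I_|T|, the ordinal i standing
   for the period i + 1. *)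
Definition period (n : nat) (i : 'I_n) : int := i.+1%:Z.

Record assignment (R : realType) (I : instance) : Type := Assignment {
  exec_var : 'I_(horizon I) -> maint I -> R;
  start_var : 'I_(horizon I) -> maint I -> R }.

(* Extension by zero to all integer periods: the value is 0 for t <= 0 and for
   t > |T|. *)
Definition extend (R : realType) (I : instance)
    (v : 'I_(horizon I) -> maint I -> R) (t : int) (m : maint I) : R :=
  if [pick i | period i == t] is Some i then v i m else 0.

Definition exec (R : realType) (I : instance) (a : assignment R I) :=
  extend (exec_var a).

Definition start (R : realType) (I : instance) (a : assignment R I) :=
  extend (start_var a).

Definition no_late_start (R : realType) (I : instance) (a : assignment R I) :=
  forall (t : 'I_(horizon I)) (m : maint I),
    (horizon I)%:Z - (duration m)%:Z + 2 <= period t -> start a (period t) m = 0.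

(* The variable domain D is a parameter: a formulation is its set of
   constraints for D = {0, 1}, and its linear relaxation is the same set of
   constraints for D = [0, 1]. *)
Definition formulation (R : realType) : Type :=
  {pred R} -> forall I : instance, assignment R I -> Prop.

Definition F1 (R : realType) : formulation R := fun D I a =>
  [/\ forall m, \sum_(t < horizon I) exec a (period t) m = (duration m)%:R,
      forall m, \sum_(t < horizon I) start a (period t) m = 1,
      forall (t : 'I_(horizon I)) m,
        exec a (period t) m - exec a (period t - 1) m <= start a (period t) m &
      forall (t : 'I_(horizon I)) m,
        exec a (period t) m \in D /\ start a (period t) m \in D].

(* The sum over t' from t - W_m + 1 to t is indexed by
   k = t' - (t - W_m + 1), so that t' may be nonpositive. *)
Definition F7 (R : realType) : formulation R := fun D I a =>
  [/\ forall m, \sum_(t < horizon I) start a (period t) m = 1,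
      forall (t : 'I_(horizon I)) m,
        \sum_(0 <= k < duration m)
          start a (period t - (duration m)%:Z + 1 + k%:Z) m = exec a (period t) m &
      forall (t : 'I_(horizon I)) m,
        exec a (period t) m \in D /\ start a (period t) m \in D].

Definition solution (R : realType) (F : formulation R) (D : {pred R})
    (I : instance) (a : assignment R I) : Prop :=
  no_late_start a /\ F D I a.

Definition integer_solution (R : realType) (F : formulation R)
    (I : instance) (a : assignment R I) : Prop :=
  solution F [pred x | (x == 0) || (x == 1)] a.

Definition continuous_solution (R : realType) (F : formulation R)
    (I : instance) (a : assignment R I) : Prop :=
  solution F (mem `[0, 1]) a.

Definition at_least_as_tight (R : realType) (A B : formulation R) : Prop :=
  forall (I : instance) (a : assignment R I),
    continuous_solution A a -> continuous_solution B a.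

Definition strictly_tighter (R : realType) (A B : formulation R) : Prop :=
  at_least_as_tight A B /\
  exists (I : instance) (a : assignment R I),
    continuous_solution B a /\ ~ continuous_solution A a.

(* Main.v *)
Require Import Defs.
From mathcomp Require Import all_boot all_order all_algebra.
From mathcomp Require Import reals.
From mathcomp Require Import zify lra.

Set Implicit Arguments.
Unset Strict Implicit.
Unset Printing Implicit Defensive.

Import Order.TTheory GRing.Theory Num.Theory.
Local Open Scope ring_scope.

(** Fix a maintenance of duration [W] and write [s] for its start variables,
    extended by zero to all integers.  In F7 the execution variable of period
    [t] is the sum of [s] over the window of the [W] periods that end at [t].
    Both constraints of F1 that F7 does not state follow from this.

    Summing over [t] and exchanging the two sums gives [W] sums of [s], each
    translated by some [d < W].  Translating loses no mass, because [s] vanishes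
    before period 1 and, as late starts are excluded, on the last [d] periods
    of the horizon; so each of these sums is 1 ([sum_translate]) and the total
    is [W].

    Two consecutive windows differ by one period at each end, so the increment
    of the execution variable at [t] is [s t - s (t - W)], which is at most
    [s t] because [s] is nonnegative ([sum_window_step]).  At [t = 1] this also
    uses that the window ending at period 0 has sum zero, which agrees with the
    convention for the execution variable there.

    The converse inclusion fails because F1 bounds only the increments of the
    execution variables: with two periods and a maintenance of duration 1, one
    may start it fully in period 1 and execute one half of it in each period. *)

(** * Sums over windows of integers *)

(** Passing from [d] to [d + 1] drops the value at [n - d] and gains the value
    at [- d], both zero. *)
Lemma sum_translate (V : zmodType) (n d : nat) (f : int -> V) :
    (forall u : int, u <= 0 -> f u = 0) ->
    (forall u : int, n%:Z - d%:Z < u -> f u = 0) ->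
  \sum_(i < n) f (i.+1%:Z - d%:Z) = \sum_(i < n) f i.+1%:Z.
Proof.
move=> f_le0; elim: d => [|d IHd] f_gt.
  by apply: eq_bigr => i _; rewrite subr0.
rewrite -IHd; last by move=> u u_gt; apply: f_gt; lia.
apply/esym/eqP; rewrite -subr_eq0 -sumrB.
rewrite -(big_mkord xpredT
  (fun i => f (i.+1%:Z - d%:Z) - f (i.+1%:Z - d.+1%:Z))).
rewrite (@telescope_sumr_eq _ _ _ (fun i : nat => f (i%:Z - d%:Z))) //.
  rewrite (f_gt (n%:Z - d%:Z)); last by lia.
  by rewrite (f_le0 (0%:Z - d%:Z)) ?subr0 //; lia.
by move=> i _; congr (_ - f _); lia.
Qed.

Lemma sum_window_step (V : zmodType) (W : nat) (t : int) (f : int -> V) :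
  \sum_(0 <= k < W) f (t - W%:Z + 1 + k%:Z)
    - \sum_(0 <= k < W) f (t - 1 - W%:Z + 1 + k%:Z) = f t - f (t - W%:Z).
Proof.
rewrite -sumrB (@telescope_sumr_eq _ _ _ (fun k : nat => f (t - W%:Z + k%:Z))) //.
  by congr (f _ - f _); lia.
by move=> k _; congr (f _ - f _); lia.
Qed.

(** * Variables extended by zero *)

Section Extension.

Variables (R : realType) (I : instance).
Implicit Types (v : 'I_(horizon I) -> maint I -> R) (a : assignment R I).

Lemma extend_period v i m : extend v (period i) m = v i m.
Proof.
rewrite /extend; case: pickP => [j /eqP|/(_ i)]; last by rewrite eqxx.
by rewrite /period => ji; congr v; apply: val_inj => /=; lia.
Qed.

(** Lets facts stated for the periods of the horizon be extended to all
    integers by treating one extra, trivial, case. *)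
Lemma extend_cases v (t : int) m :
  (exists i : 'I_(horizon I), t = period i) \/ extend v t m = 0.
Proof.
by rewrite /extend; case: pickP => [i /eqP <-|_]; [left; exists i | right].
Qed.

Lemma extend_le0 v (t : int) m : t <= 0 -> extend v t m = 0.
Proof.
by case: (extend_cases v t m) => // -[i ->]; rewrite /period; lia.
Qed.

Lemma start_late a (t : int) m : no_late_start a ->
  (horizon I)%:Z - (duration m)%:Z + 2 <= t -> start a t m = 0.
Proof.
move=> late; case: (extend_cases (start_var a) t m) => // -[i ->].
exact: late.
Qed.

(** * F7 is at least as tight as F1 *)

(** In the sum over [t], the term of index [k] of the window is the translate
    of the start variables by [W - 1 - k]. *)
Lemma sum_windows a m : no_late_start a ->
    \sum_(t < horizon I) start a (period t) m = 1 ->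
  \sum_(t < horizon I) \sum_(0 <= k < duration m)
    start a (period t - (duration m)%:Z + 1 + k%:Z) m = (duration m)%:R.
Proof.
move=> late sum1; rewrite exchange_big /=.
under eq_big_nat => k /andP[_ ltkW].
  have -> : \sum_(t < horizon I)
      start a (period t - (duration m)%:Z + 1 + k%:Z) m = 1.
    rewrite -sum1.
    rewrite -[RHS](@sum_translate R (horizon I) ((duration m).-1 - k)
                                  (fun u => start a u m)).
    - by apply: eq_bigr => t _; congr (start a _ m); rewrite /period; lia.
    - by move=> u; apply: extend_le0.
    - by move=> u u_gt; apply: start_late => //; lia.
  over.
by rewrite sumr_const_nat subn0.
Qed.

End Extension.

Lemma F7_at_least_as_tight_F1 (R : realType) :
  at_least_as_tight (@F7 R) (@F1 R).
Proof.
move=> I a [late [sum1 window dom]]; split=> //; split=> // [m|t m].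
  rewrite -(sum_windows late (sum1 m)).
  by apply: eq_bigr => t _; rewrite window.
have start_ge0 u : 0 <= start a u m.
  case: (extend_cases (start_var a) u m) => [[i ->]|]; last first.
    by rewrite /start => ->.
  by have [_] := dom i m; rewrite /= in_itv /= => /andP[].
have window_prev : exec a (period t - 1) m =
    \sum_(0 <= k < duration m)
      start a (period t - 1 - (duration m)%:Z + 1 + k%:Z) m.
  case: t => -[|i] lti.
    (* The first period: the window lies entirely before the horizon. *)
    rewrite /exec extend_le0 // big_nat_cond big1 // => k /andP[/andP[_ ltkW] _].
    by apply: extend_le0; rewrite /period /=; lia.
  have -> : period (Ordinal lti) - 1 = period (Ordinal (ltnW lti)).
    by rewrite /period /=; lia.
  by rewrite window.
rewrite -window window_prev.
rewrite (@sum_window_step _ _ _ (fun u => start a u m)).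
by rewrite lerBlDr lerDl.
Qed.

(** * A solution of the relaxation of F1 outside that of F7 *)

Definition two_period_instance : instance :=
  @Instance 2 unit (eq_leq (esym card_unit)) (fun=> 1%N) (fun=> isT).

Definition split_execution (R : realType) : assignment R two_period_instance :=
  @Assignment R two_period_instance
    (fun _ _ => 2^-1) (fun i _ => (i == 0%N :> nat)%:R).

Lemma split_execution_F1 (R : realType) :
  continuous_solution (@F1 R) (split_execution R).
Proof.
split=> [t m|].
  rewrite /period; case: t => t ltt /= late.
  by exfalso; move: ltt late => /=; lia.
split=> [m|m|t m|t m].
- by rewrite !big_ord_recl big_ord0 /exec !extend_period /=; lra.
- by rewrite !big_ord_recl big_ord0 /start !extend_period /=; lra.
- rewrite /exec /start !extend_period /=.
  case: t => -[|[|//]] ltt /=.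
    by rewrite extend_le0 //; lra.
  have -> : period (Ordinal ltt) - 1 = period (ord0 : 'I_2).
    by rewrite /period /=; lia.
  by rewrite (@extend_period _ two_period_instance) /=; lra.
- rewrite /exec /start !extend_period /= !in_itv /=.
  by split; [|case: (_ == _) => /=]; apply/andP; split; lra.
Qed.

(** For duration 1 the window is a single period, so F7 forces the start and
    execution variables to coincide; here they are 1 and 1/2 in period 1. *)
Lemma split_execution_not_F7 (R : realType) :
  ~ continuous_solution (@F7 R) (split_execution R).
Proof.
case=> _ [_ /(_ (ord0 : 'I_2) tt) window _]; move: window.
rewrite big_nat1 subrK addr0 /exec /start !extend_period /=.
lra.
Qed.

Theorem proposition3p1 (R : realType) : strictly_tighter (@F7 R) (@F1 R).
Proof.
split; first exact: F7_at_least_as_tight_F1.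
exists two_period_instance, (split_execution R).
by split; [exact: split_execution_F1 | exact: split_execution_not_F7].
Qed.
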